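(* Let $G$ be a graph whose maximum degree is $3$ and with $|V(G)|>4$. Then $\mu(G)\leq 2$.
   Context: Multi-graphs have no self-loops; the skeleton of a multi-graph is its underlying simple graph. Each edge $e$ between $u$ and $v$ consists of two half-edges $e_u$ and $e_v$. A half-edge colouring is a function $c$ from the set of half-edges to $\mathbb{N}_0$; each edge $e$ also gets a weight $w(e)\in\mathbb{C}$. The weight of a perfect matching $P$ is $\prod_{e\in P}w(e)$. A vertex colouring is a map $vc:V\to\mathbb{N}_0$; it filters out the subgraph consisting of all edges $e$ (between $u,v$) with $c(e_u)=vc(u)$ and $c(e_v)=vc(v)$ (with the same weights). The weight of $vc$ is the sum of the weights of all perfect matchings of this filtered subgraph; $vc$ is feasible if the filtered subgraph has at least one perfect matching (an infeasible colouring has weight $0$). An edge-coloured edge-weighted multi-graph is GHZ if every feasible monochromatic vertex colouring has weight $1$ and every non-monochromatic vertex colouring has weight $0$; its dimension is the number of feasible monochromatic vertex colourings. For a simple graph $G$, the matching index $\mu(G)$ is the maximum (possibly $\infty$) of the dimension over all GHZ edge-coloured edge-weighted multi-graphs whose skeleton is $G$. *)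

(* Defs.v *)
From HB Require Import structures.
From mathcomp Require Import all_boot all_order all_algebra.
From mathcomp Require Import complex.
From mathcomp Require Import Rstruct.
Set Implicit Arguments. Unset Strict Implicit. Unset Printing Implicit Defensive.
Import Order.TTheory GRing.Theory Num.Theory.
Local Open Scope ring_scope.

Definition Cplx : numClosedFieldType := (Rdefinitions.R)[i].

Definition simple_graph (T : finType) (g : rel T) : Prop :=
  irreflexive g /\ symmetric g.

Definition degree (T : finType) (g : rel T) (v : T) : nat := #|[set u | g v u]|.

Definition max_degree (T : finType) (g : rel T) : nat := \max_(v : T) degree g v.

(* A multigraph on vertex set T: a finite edge type E and endpoints
   ends e = (u, v); no self-loops.  The half-edge e_u of e at its first
   endpoint is (e, false), the half-edge e_v at its second endpoint is
   (e, true). *)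
Definition loopless (T E : finType) (ends : E -> T * T) : Prop :=
  forall e, (ends e).1 != (ends e).2.

Definition has_skeleton (T E : finType) (ends : E -> T * T) (g : rel T) : Prop :=
  forall u v, g u v <-> exists e, ends e = (u, v) \/ ends e = (v, u).

Definition incident (T E : finType) (ends : E -> T * T) (x : T) (e : E) : bool :=
  ((ends e).1 == x) || ((ends e).2 == x).

Definition filtered (T E : finType) (ends : E -> T * T) (c : E -> bool -> nat)
  (vc : T -> nat) (e : E) : bool :=
  (c e false == vc (ends e).1) && (c e true == vc (ends e).2).

Definition perfect_matching (T E : finType) (ends : E -> T * T)
  (c : E -> bool -> nat) (vc : T -> nat) (P : {set E}) : bool :=
  [forall e in P, filtered ends c vc e] &&
  [forall x : T, #|[set e in P | incident ends x e]| == 1%N].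

Definition vc_weight (T E : finType) (ends : E -> T * T) (c : E -> bool -> nat)
  (w : E -> Cplx) (vc : T -> nat) : Cplx :=
  \sum_(P : {set E} | perfect_matching ends c vc P) \prod_(e in P) w e.

Definition feasible (T E : finType) (ends : E -> T * T) (c : E -> bool -> nat)
  (vc : T -> nat) : Prop :=
  exists P : {set E}, perfect_matching ends c vc P.

Definition monochromatic (T : finType) (vc : T -> nat) : Prop :=
  forall u v, vc u = vc v.

Definition GHZ (T E : finType) (ends : E -> T * T) (c : E -> bool -> nat)
  (w : E -> Cplx) : Prop :=
  forall vc : T -> nat,
    (monochromatic vc -> feasible ends c vc -> vc_weight ends c w vc = 1) /\
    (~ monochromatic vc -> vc_weight ends c w vc = 0).

Definition dimension_le (T E : finType) (ends : E -> T * T)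
  (c : E -> bool -> nat) (d : nat) : Prop :=
  forall s : seq nat, uniq s ->
    (forall k, k \in s -> feasible ends c (fun _ => k)) -> (size s <= d)%N.

Definition matching_index_le (T : finType) (g : rel T) (d : nat) : Prop :=
  forall (E : finType) (ends : E -> T * T) (c : E -> bool -> nat) (w : E -> Cplx),
    loopless ends -> has_skeleton ends g -> GHZ ends c w -> dimension_le ends c d.

(* Main.v *)
(* Restrict to three feasible colours. Contracting the GHZ tensor at a vertex v
   with a generic vector, and at two neighbours with vectors orthogonal to the
   resulting edge vectors, leaves a diagonal matrix equal to a rank one matrix.
   This forces the three edges at v to be monochromatic, one for each colour.
   Hence the colours give involutions f p of the vertices, and every matching
   made of edges {v, f p v} is the only one inducing its vertex colouring, so
   it has nonzero weight and must be monochromatic. As in Bogdanov's argument,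
   two of the colours then form a Hamiltonian cycle, and a shortest chord of the
   third colour, together with a chord crossing it, yields a matching that is not
   monochromatic as soon as there are more than four vertices. *)

Require Import Defs.
From mathcomp Require Import all_boot all_order all_algebra.
From mathcomp Require Import zify ring.
Set Implicit Arguments. Unset Strict Implicit. Unset Printing Implicit Defensive.
Import Order.TTheory GRing.Theory Num.Theory.
Local Open Scope ring_scope.

(** * Matchings made of three involutions *)

(* The selection used is [c] on [E], [b] on [K] minus [E], and [a] off [K]. *)
Lemma selection_closed (T : finType) (C : eqType) (f : C -> T -> T)
    (K E : pred T) (a b c : C) (x0 : T) :
    (forall d, involutive (f d)) ->
    (forall s : T -> C,
       (forall v, s (f (s v) v) = s v) -> forall u v, s u = s v) ->
    c != a -> c != b -> E x0 -> {subset E <= K} ->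
    (forall x, E x -> E (f c x)) -> (forall x, K x -> K (f a x)) ->
    (forall x, K x -> ~~ E x -> K (f b x) && ~~ E (f b x)) ->
  forall x, E x.
Proof.
move=> fK sconst ca cb Ex0 EK Ec Ka KEb x.
pose s x := if E x then c else if K x then b else a.
have s_const := sconst s.
have /s_const/(_ x x0) : forall v, s (f (s v) v) = s v.
  move=> v; rewrite {2 3}/s; case: (boolP (E v)) => [Ev|nEv].
    by rewrite /s Ec.
  case: (boolP (K v)) => Kv.
    by have /andP[Kb /negPf Eb] := KEb v Kv nEv; rewrite /s Eb Kb.
  have nK : ~~ K (f a v) by apply: contra Kv => /Ka; rewrite fK.
  by rewrite /s (negPf nK); case: ifP => // /EK; rewrite unfold_in (negPf nK).
rewrite /s Ex0; case: (E x) => //; case: (K x) => /eqP; rewrite eq_sym.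
  by rewrite (negPf cb).
by rewrite (negPf ca).
Qed.

(** The edge between positions [k] and [k.+1] of the walk has colour [odd k], so colours are read
    off from the parity of positions. *)
Fixpoint alternating (T : Type) (f : bool -> T -> T) (x : T) (k : nat) : T :=
  if k is k'.+1 then f (odd k') (alternating f x k') else x.

(** If [d >= 2] were odd, the edge leaving position [a] forwards and the one leaving [a + d]
    backwards would have the same colour; following both gives a coincidence at distance [d - 2].
    The descent ends at distance 1, that is, at a fixed point. *)
Lemma alternating_parity (T : eqType) (f : bool -> T -> T) (x : T) :
    (forall b, involutive (f b)) -> (forall b y, f b y != y) ->
  forall d a, alternating f x a = alternating f x (a + d) -> ~~ odd d.
Proof.
move=> fK fN d; have [m] := ubnP d; elim: m d => // m IHm [|[|d]] // lt_dm a.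
  by rewrite addn1 /= => /esym/eqP; rewrite (negPf (fN _ _)).
rewrite !addnS /= negbK => /(congr1 (f (odd a))) eq_f; apply/negP => odd_d.
have: ~~ odd d; last by rewrite odd_d.
apply: (IHm d _ a.+1); first by lia.
by rewrite addSn /= eq_f oddD odd_d addbT negbK fK.
Qed.

(** As [d] is even, positions [j] and [j + d] are left by the same injective step, so a coincidence
    spreads back to 0 and then forward to every index. *)
Lemma alternating_period (T : eqType) (f : bool -> T -> T) (x : T) (d a : nat) :
    (forall b, involutive (f b)) -> ~~ odd d ->
    alternating f x a = alternating f x (a + d) ->
  forall i, alternating f x i = alternating f x (i + d).
Proof.
move=> fK ev_d eq_a i; have eq_0 : alternating f x 0 = alternating f x (0 + d).
  elim: a eq_a => // a IHa; rewrite addSn /= oddD (negPf ev_d) addbF.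
  by move/(can_inj (fK _))/IHa.
by elim: i => // i IHi; rewrite addSn /= -IHi oddD (negPf ev_d) addbF.
Qed.

(** The positions from [i] to [l.-1] are even in number and are paired, two consecutive ones at a
    time, by the edges of colour [odd i]. *)
Lemma alternating_arc (T : eqType) (f : bool -> T -> T) (x : T) (i l j : nat) :
    (forall b, involutive (f b)) -> odd i = odd l -> (i <= j < l)%N ->
  exists2 j', (i <= j' < l)%N
    & f (odd i) (alternating f x j) = alternating f x j'.
Proof.
move=> fK odd_il ij.
have [odd_ij|odd_ij] := eqVneq (odd i) (odd j).
  by exists j.+1; rewrite /= ?odd_ij //; lia.
case: j => [|j] in ij odd_ij *.
  by rewrite (_ : i = 0%N) ?eqxx in odd_ij; lia.
exists j; first by lia.
by rewrite /= (_ : odd i = odd j) ?fK //; move: odd_ij => /=; lia.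
Qed.

(** An odd chord has an even number of positions strictly inside its arc. Colour [c] on the chord,
    [cl (odd i.+1)] inside and [cl (odd i)] off the arc form a consistent selection; since it is
    constant, the ends of the chord are the only vertices. *)
Lemma alternating_odd_chord (T : finType) (C : eqType) (f : C -> T -> T)
    (cl : bool -> C) (c : C) (x : T) (i l : nat) :
    (forall d, involutive (f d)) ->
    (forall s : T -> C,
       (forall v, s (f (s v) v) = s v) -> forall u v, s u = s v) ->
    (forall b, c != cl b) ->
    let p := alternating (fun b => f (cl b)) x in
    (i < l)%N -> odd (l - i) ->
    {in [pred j | i <= j <= l]%N &, injective p} ->
    f c (p i) = p l ->
  (#|T| <= 2)%N.
Proof.
move=> fK sconst c_cl p lt_il odd_il p_inj chord.
have clK b : involutive (f (cl b)) by exact: fK.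
pose E : pred T := [pred y | (y == p i) || (y == p l)].
pose K : pred T := [pred y | y \in [seq p j | j <- index_iota i l.+1]].
have inK j : (i <= j <= l)%N -> K (p j).
  by move=> ij; apply: map_f; rewrite mem_index_iota; lia.
have EP : forall y, E y.
  apply: (@selection_closed T C f K E (cl (odd i)) (cl (odd i.+1)) c (p i)) => //.
  - by rewrite /E /= eqxx.
  - by move=> y /orP[]/eqP->; apply: inK; lia.
  - move=> y /orP[]/eqP->; first by rewrite chord /E /= eqxx orbT.
    by rewrite -chord fK /E /= eqxx.
  - move=> y /mapP[j + ->]; rewrite mem_index_iota => ij.
    have [||j' ij' ->] := @alternating_arc _ (fun b => f (cl b)) x i l.+1 j clK.
    + by rewrite /=; lia.
    + by [].
    by apply: inK; lia.
  - move=> y /mapP[j + ->]; rewrite mem_index_iota => ij nE.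
    have ij1 : (i.+1 <= j < l)%N.
      have : j != i by apply: contra nE => /eqP->; rewrite /E /= eqxx.
      have : j != l by apply: contra nE => /eqP->; rewrite /E /= eqxx orbT.
      by lia.
    have [||j' ij' ->] := @alternating_arc _ (fun b => f (cl b)) x i.+1 l j clK.
    + by rewrite /=; lia.
    + by [].
    rewrite inK /=; last lia.
    by apply/negP => /orP[]/eqP/p_inj; rewrite !inE; lia.
apply: leq_trans (_ : size [:: p i; p l] <= 2)%N => //.
rewrite cardE; apply: uniq_leq_size (enum_uniq _) _ => y _.
by rewrite !inE; exact: EP.
Qed.

(* The matching behind this: the edges of colour [c] at [p i] and [p i.+1],
   alternate edges along the arcs between their ends, and edges of colour
   [cl (odd i)] outside [p i .. p l]. *)
Lemma alternating_crossing_chords (T : finType) (C : eqType) (f : C -> T -> T)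
    (cl : bool -> C) (c : C) (x : T) (i k l : nat) :
    (forall d, involutive (f d)) ->
    (forall s : T -> C,
       (forall v, s (f (s v) v) = s v) -> forall u v, s u = s v) ->
    (forall b, c != cl b) ->
    let p := alternating (fun b => f (cl b)) x in
    (i.+1 < k < l)%N -> ~~ odd (k - i) -> odd (l - i) ->
    {in [pred j | i <= j <= l]%N &, injective p} ->
    f c (p i) = p k -> f c (p i.+1) = p l ->
  (#|T| <= 4)%N.
Proof.
move=> fK sconst c_cl p /andP[lt_ik lt_kl] ev_ik odd_il p_inj chord1 chord2.
have clK b : involutive (f (cl b)) by exact: fK.
pose E : pred T := [pred y | [|| y == p i, y == p i.+1, y == p k | y == p l]].
(* [K] is made of two arcs, each paired internally by colour [cl (odd i)]. The positions strictly
   between [i.+1] and [k] lie off [K] and take that colour too. *)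
pose K : pred T :=
  [pred y | (y \in [seq p j | j <- index_iota i i.+2])
         || (y \in [seq p j | j <- index_iota k l.+1])].
have inK j : (i <= j <= i.+1)%N || (k <= j <= l)%N -> K (p j).
  by move=> /orP[] ij; apply/orP; [left|right]; apply: map_f;
     rewrite mem_index_iota; lia.
have E1 : E (p i) by rewrite /E /= eqxx.
have E2 : E (p i.+1) by rewrite /E inE eqxx orbT.
have E3 : E (p k) by rewrite /E inE eqxx !orbT.
have E4 : E (p l) by rewrite /E inE eqxx !orbT.
have EP : forall y, E y.
  apply: (@selection_closed T C f K E (cl (odd i)) (cl (odd i.+1)) c (p i)) => //.
  - by move=> y /or4P[]/eqP->; apply: inK; lia.
  - move=> y /or4P[]/eqP->; rewrite ?chord1 ?chord2 //.
      by rewrite -chord1 fK.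
    by rewrite -chord2 fK.
  - move=> y /orP[]/mapP[j + ->]; rewrite mem_index_iota => ij.
    + have [||j' ij' ->] := @alternating_arc _ (fun b => f (cl b)) x i i.+2 j clK.
      * by rewrite /=; lia.
      * by [].
      by apply: inK; lia.
    + have -> : odd i = odd k by lia.
      have [||j' ij' ->] := @alternating_arc _ (fun b => f (cl b)) x k l.+1 j clK.
      * by rewrite /=; lia.
      * by [].
      by apply: inK; lia.
  - move=> y Ky nE; have [j kj ey] : exists2 j, (k.+1 <= j < l)%N & y = p j.
      case/orP: Ky => /mapP[j]; rewrite mem_index_iota => ij ey; exists j => //.
        have [ej|ej] : j = i \/ j = i.+1 by lia.
          by rewrite ey ej E1 in nE.
        by rewrite ey ej E2 in nE.
      have : j != k by apply: contra nE => /eqP ej; rewrite ey ej.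
      have : j != l by apply: contra nE => /eqP ej; rewrite ey ej.
      by lia.
    rewrite {}ey {y Ky nE}.
    have -> : odd i.+1 = odd k.+1 by rewrite /=; lia.
    have [||j' ij' ->] := @alternating_arc _ (fun b => f (cl b)) x k.+1 l j clK.
    + by rewrite /=; lia.
    + by [].
    rewrite inK /=; last lia.
    by apply/negP => /or4P[]/eqP/p_inj; rewrite !inE; lia.
apply: leq_trans (_ : size [:: p i; p i.+1; p k; p l] <= 4)%N => //.
rewrite cardE; apply: uniq_leq_size (enum_uniq _) _ => y _.
by rewrite !inE; exact: EP.
Qed.

(** The two colours [cl] close up into a Hamiltonian cycle of even length [n]. Every edge of colour
    [c] is then a chord of it, and induction on the length excludes all chords. *)
Lemma constant_selections_card (T : finType) (C : eqType) (f : C -> T -> T)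
    (cl : bool -> C) (c : C) :
    (forall d, involutive (f d)) -> (forall d v, f d v != v) ->
    injective cl -> (forall b, c != cl b) ->
    (forall s : T -> C,
       (forall v, s (f (s v) v) = s v) -> forall u v, s u = s v) ->
  (#|T| <= 4)%N.
Proof.
move=> fK fN cl_inj c_cl sconst; rewrite leqNgt; apply/negP => card_T.
have [x _] : exists x : T, x \in T by apply/card_gt0P; exact: leq_trans card_T.
pose p := alternating (fun b => f (cl b)) x.
have clK b : involutive (f (cl b)) by exact: fK.
have clN b y : f (cl b) y != y by exact: fN.
have parity d a : p a = p (a + d)%N -> ~~ odd d by exact: alternating_parity.
have period d a : p a = p (a + d)%N -> forall i, p i = p (i + d)%N.
  by move=> eq_p; apply: alternating_period (clK) (parity _ _ eq_p) eq_p.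
have exn : exists n, (0 < n)%N && (p 0%N == p n).
  have : ~~ injectiveb (fun i : 'I_#|T|.+1 => p i).
    by apply/injectiveP => /leq_card; rewrite card_ord ltnn.
  case/injectivePn => i [j ij eq_p].
  wlog lt_ij : i j ij eq_p / (i < j)%N.
    move=> gen; case: (ltngtP i j) => [|ji|/val_inj/eqP]; first exact: gen.
      by apply: (gen j i) => //; rewrite eq_sym.
    by rewrite (negPf ij).
  exists (j - i)%N; rewrite subn_gt0 lt_ij /=; apply/eqP.
  by rewrite -[RHS]/(p (0 + _)%N); apply: (period _ i); rewrite subnKC // ltnW.
case: (ex_minnP exn) => n /andP[n_gt0 /eqP pn] n_min.
have pn_per i : p i = p (i + n)%N by apply: (period n 0%N).
have ev_n : ~~ odd n by apply: (parity n 0%N).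
(* Minimality of [n] makes the walk injective on [n] consecutive positions. *)
have p_win a b : p a = p b -> (a <= b < a + n)%N -> a = b.
  move=> eq_p ab; apply/eqP; rewrite eqn_leq; apply/andP; split; first lia.
  rewrite leqNgt; apply/negP => lt_ab.
  suff : (n <= b - a)%N by lia.
  apply: n_min; rewrite subn_gt0 lt_ab -[p (b - a)%N]/(p (0 + _)%N).
  by apply/eqP/(period _ a); rewrite subnKC // ltnW.
have p_inj i l : (l < i + n)%N -> {in [pred j | i <= j <= l]%N &, injective p}.
  move=> lt_l a b; rewrite !inE => ia ib eq_p.
  case: (leqP a b) => ab; first by apply: p_win eq_p _; lia.
  by apply/esym; apply: p_win (esym eq_p) _; lia.
have ham : forall y, exists j, p j == y.
  pose E : pred T := [pred y | y \in [seq p j | j <- index_iota 0 n]].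
  have Ecl b y : E y -> E (f (cl b) y).
    case/mapP=> j + ->; rewrite mem_index_iota => jn.
    have [eb|eb] := eqVneq b (odd j).
      have -> : f (cl b) (p j) = p j.+1 by rewrite eb.
      have [ltj|] := ltnP j.+1 n; first by apply: map_f; rewrite mem_index_iota.
      move=> nj; have -> : j.+1 = n by lia.
      by rewrite -pn; apply: map_f; rewrite mem_index_iota.
    case: j => [|j] in jn eb *.
      (* The backward edge at position 0 is the last edge of the cycle, whose colour is [true]
         because [n] is even. *)
      have -> : b = odd n.-1 by move: eb => /=; lia.
      rewrite pn -[in p n](prednK n_gt0) /p /= clK; apply: map_f.
      by rewrite mem_index_iota; lia.
    have -> : b = odd j by move: eb => /=; lia.
    by rewrite /p /= clK; apply: map_f; rewrite mem_index_iota; lia.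
  have EP : forall y, E y.
    (* With [K] equal to [E], the selection is [cl true] on the cycle and [cl false] off it; [c] is
       only assigned to the empty difference. *)
    apply: (@selection_closed T C f E E (cl false) c (cl true) x) => //.
    - by apply/eqP => /cl_inj.
    - by rewrite eq_sym.
    - by apply/mapP; exists 0%N; rewrite // mem_index_iota.
    - by move=> y; exact: Ecl.
    - by move=> y; exact: Ecl.
    - by move=> y /= ->.
  by move=> y; have /mapP[j _ ->] := EP y; exists j.
have hamw i y : exists2 j, (i <= j < i + n)%N & p j = y.
  have [j0 /eqP <-] := ham y.
  have exj : exists j, (i <= j)%N && (p j == p j0).
    exists (j0 + i * n)%N; apply/andP; split; first by nia.
    elim: i => [|i IHi]; first by rewrite addn0.
    by rewrite mulSn addnCA addnC -pn_per.
  case: (ex_minnP exj) => j /andP[ij /eqP pj] j_min; exists j => //.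
  rewrite ij /= ltnNge; apply/negP => inj.
  suff : (j <= j - n)%N by lia.
  apply: j_min; rewrite pn_per subnK; last lia.
  by rewrite pj eqxx andbT; lia.
have no_chord k : forall i, (0 < k < n)%N -> f c (p i) <> p (i + k)%N.
  have [m] := ubnP k; elim: m k => // m IHm k lt_km i kn chord.
  have [odd_k|ev_k] := boolP (odd k).
    suff : (#|T| <= 2)%N by lia.
    apply: (@alternating_odd_chord _ _ f cl c x i (i + k)%N) => //.
    - by lia.
    - by rewrite addKn.
    - by apply: p_inj; lia.
  (* The chord at the next position cannot end before [i + k], by induction, nor at [i + k] or
     [i + n], since the first chord joins these two vertices to each other. Hence the two chords
     cross. *)
  have [l il pl] := hamw i.+1 (f c (p i.+1)).
  have il1 : l != i.+1.
    by apply/eqP => el; move: (fN c (p i.+1)); rewrite -pl el eqxx.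
  have lt_ikl : (i + k < l)%N.
    rewrite ltnNge leq_eqVlt; apply/negP => /orP[/eqP el|lt_l].
      have : p i.+1 = p i by rewrite -[LHS](fK c) -pl el -chord fK.
      by move/esym/(p_inj i i.+1 _); rewrite !inE => H; lia.
    apply: (IHm (l - i.+1)%N _ i.+1); try lia.
    by rewrite -pl; congr p; lia.
  have lt_lin : (l < i + n)%N.
    rewrite ltn_neqAle; apply/andP; split; last lia.
    apply/eqP => el; have : p i.+1 = p (i + k)%N.
      by rewrite -chord -[LHS](fK c) -pl el -pn_per.
    by move/(p_inj i (i + k)%N _); rewrite !inE => H; lia.
  have [odd_l|ev_l] := boolP (odd (l - i.+1)).
    suff : (#|T| <= 2)%N by lia.
    apply: (@alternating_odd_chord _ _ f cl c x i.+1 l) => //; try lia.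
    by apply: p_inj; lia.
  suff : (#|T| <= 4)%N by lia.
  apply: (@alternating_crossing_chords _ _ f cl c x i (i + k)%N l) => //; try lia.
  by apply: p_inj.
have [l ln pl] := hamw 0%N (f c (p 0%N)).
apply: (no_chord l 0%N) => //.
rewrite andbC (_ : (l < n)%N) /=; last lia.
by rewrite lt0n; apply/eqP => l0; move: (fN c (p 0%N)); rewrite -pl l0 eqxx.
Qed.

(** * The tensor equation at a vertex *)

Lemma forall_ord3 (P : 'I_3 -> Prop) : P 0 -> P 1 -> P 2%:R -> forall i, P i.
Proof.
move=> P0 P1 P2 [[|[|[|//]]] lt_i].
- by have -> : Ordinal lt_i = 0 by apply: val_inj.
- by have -> : Ordinal lt_i = 1 by apply: val_inj.
- by have -> : Ordinal lt_i = 2%:R by apply: val_inj.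
Qed.

Lemma sum_ord3 (V : nmodType) (F : 'I_3 -> V) :
  \sum_i F i = F 0 + F 1 + F 2%:R.
Proof.
by rewrite !big_ord_recr big_ord0 /= add0r; congr (F _ + F _ + F _); apply: val_inj.
Qed.

(** If [u] is zero or has at least two nonzero entries, some orthogonal vector has no zero
    coordinate. A zero of [y] thus detects that [u] is supported at that coordinate alone. *)
Lemma orthogonal_nonzero (K : numFieldType) (u : 'I_3 -> K) :
  exists2 y : 'I_3 -> K, \sum_i u i * y i = 0
    & forall i, y i = 0 -> forall j, (u j != 0) = (j == i).
Proof.
suff [y0 [y1 [y2 [sum_y y0P y1P y2P]]]] : exists y0 y1 y2 : K,
    [/\ u 0 * y0 + u 1 * y1 + u 2%:R * y2 = 0,
        y0 != 0 \/ [/\ u 0 != 0, u 1 = 0 & u 2%:R = 0],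
        y1 != 0 \/ [/\ u 0 = 0, u 1 != 0 & u 2%:R = 0]
      & y2 != 0 \/ [/\ u 0 = 0, u 1 = 0 & u 2%:R != 0]].
  exists (fun i : 'I_3 => [:: y0; y1; y2]`_i); first by rewrite sum_ord3.
  have supp i : (forall j, (u j != 0) = (j == i)) <->
      [/\ (u 0 != 0) = (0 == i), (u 1 != 0) = (1 == i)
        & (u 2%:R != 0) = (2%:R == i)].
    by split=> [uP|[? ? ?]]; [split; apply: uP|exact: forall_ord3].
  apply: forall_ord3 => /= y_0; apply/supp.
  - case: y0P => [|[-> -> ->]]; last by rewrite eqxx.
    by rewrite y_0 eqxx.
  - by case: y1P => [|[-> -> ->]]; rewrite ?y_0 eqxx.
  - by case: y2P => [|[-> -> ->]]; rewrite ?y_0 eqxx.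
have [u0|u0] := eqVneq (u 0) 0; have [u1|u1] := eqVneq (u 1) 0;
  have [u2|u2] := eqVneq (u 2%:R) 0.
- exists 1, 1, 1; split; [rewrite ?u0 ?u1 ?u2; ring|..];
    by [left; rewrite ?oppr_eq0 ?oner_eq0|right].
- exists 1, 1, 0; split; [rewrite ?u0 ?u1 ?u2; ring|..];
    by [left; rewrite ?oppr_eq0 ?oner_eq0|right].
- exists 1, 0, 1; split; [rewrite ?u0 ?u1 ?u2; ring|..];
    by [left; rewrite ?oppr_eq0 ?oner_eq0|right].
- exists 1, (u 2%:R), (- u 1); split; [rewrite ?u0 ?u1 ?u2; ring|..];
    by [left; rewrite ?oppr_eq0 ?oner_eq0|right].
- exists 0, 1, 1; split; [rewrite ?u0 ?u1 ?u2; ring|..];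
    by [left; rewrite ?oppr_eq0 ?oner_eq0|right].
- exists (u 2%:R), 1, (- u 0); split; [rewrite ?u0 ?u1 ?u2; ring|..];
    by [left; rewrite ?oppr_eq0 ?oner_eq0|right].
- exists (u 1), (- u 0), 1; split; [rewrite ?u0 ?u1 ?u2; ring|..];
    by [left; rewrite ?oppr_eq0 ?oner_eq0|right].
- suff [t t0 ut] : exists2 t : K, t != 0 & u 0 + t * u 1 != 0.
    exists (u 2%:R), (t * u 2%:R), (- (u 0 + t * u 1)).
    split; [ring|by left|left|by left; rewrite oppr_eq0].
    by rewrite mulf_neq0.
  have [u01|] := eqVneq (u 0 + u 1) 0; last by exists 1; rewrite ?oner_eq0 ?mul1r.
  exists 2%:R; first by rewrite pnatr_eq0.
  by rewrite mulrDl mul1r addrA u01 add0r.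
Qed.

(** Powers of one number [n] serve as [x]: both sums become values at [n] of nonzero polynomials,
    and some natural number avoids their roots. *)
Lemma generic_combination (K : numFieldType) (u v : 'I_3 -> K) :
    (exists i, u i != 0) -> (exists i, v i != 0) ->
  exists x : 'I_3 -> K,
    [/\ forall i, x i != 0, \sum_i x i * u i != 0 & \sum_i x i * v i != 0].
Proof.
pose P (w : 'I_3 -> K) := \poly_(i < 3) w (inord i).
have P_neq0 w : (exists i, w i != 0) -> P w != 0.
  case=> i; apply: contra => /eqP/(congr1 (fun q : {poly K} => q`_i)).
  by rewrite coef_poly ltn_ord coef0 inord_val => ->.
have P_eval w t : (P w).[t] = \sum_i t ^+ (i : 'I_3) * w i.
  by rewrite horner_poly; apply: eq_bigr => i _; rewrite inord_val mulrC.
move=> /P_neq0 Pu /P_neq0 Pv.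
(* The factor ['X] keeps [n] nonzero, as the entries of [x] require. *)
have : exists2 n : nat, true & ('X * (P u * P v)).[n%:R] != 0.
  set Q := _ * _; have Q0 : Q != 0 by rewrite !mulf_neq0 ?polyX_eq0.
  suff /allPn[_ /mapP[n _ ->] nroot] :
      ~~ all (root Q) [seq n%:R | n <- iota 0 (size Q)] by exists n.
  apply/negP => /(max_poly_roots Q0); rewrite size_map size_iota ltnn.
  rewrite map_inj_uniq ?iota_uniq; first by move/(_ isT).
  by move=> m n /eqP; rewrite eqr_nat => /eqP.
case=> n _; rewrite !hornerM hornerX !P_eval !mulf_eq0 !negb_or.
case/and3P=> n0 un vn; exists (fun i => n%:R ^+ i); split => // i.
exact: expf_neq0.
Qed.

(** Two nonzero columns would both be seen by one generic [x], so only column [i] is nonzero. A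
    vector orthogonal to it without zero coordinates would make all sums vanish; so
    [orthogonal_nonzero] must return a zero, and the column has a single nonzero entry. *)
Lemma single_entry (K : numFieldType) (A : 'I_3 -> 'I_3 -> K) :
    (forall x : 'I_3 -> K, (forall p, x p != 0) ->
       exists i, forall q, (\sum_p x p * A p q != 0) = (q == i)) ->
  exists m i, forall p q, (A p q != 0) = (p == m) && (q == i).
Proof.
move=> Ax; have [i Ai] := Ax (fun=> 1) (fun=> oner_neq0 K).
have [p0 Ap0] : exists p, A p i != 0.
  apply/existsP; rewrite -negb_forall; apply/negP => /forallP Ai0.
  move: (Ai i); rewrite eqxx big1 ?eqxx // => p _.
  by rewrite (eqP (Ai0 p)) mulr0.
have Aq p q : q != i -> A p q = 0.
  move=> qi; apply/eqP/negPn/negP => Apq.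
  have [x [x0 xi xq]] := @generic_combination K (A^~ i) (A^~ q)
    (ex_intro _ p0 Ap0) (ex_intro _ p Apq).
  have [j xj] := Ax x x0; move: xi xq qi; rewrite /= !xj => /eqP-> /eqP->.
  by rewrite eqxx.
have [y yA y0P] := orthogonal_nonzero (A^~ i).
have /existsP[m /eqP/y0P Am] : [exists m, y m == 0].
  rewrite -[X in is_true X]negbK negb_exists; apply/negP => /forallP y0.
  have [j /(_ j)] := Ax y y0; rewrite eqxx; have [->|/Aq Aj0] := eqVneq j i.
    by under eq_bigr do rewrite mulrC; rewrite yA eqxx.
  by rewrite big1 ?eqxx // => p _; rewrite Aj0 mulr0.
exists m, i => p q; have [->|/Aq->] := eqVneq q i; last by rewrite eqxx andbF.
by rewrite Am andbT.
Qed.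

Lemma sum_delta (K : numFieldType) (x : 'I_3 -> K) (q : 'I_3) (b : bool) :
  \sum_p x p * ((p == q) && b)%:R = x q * b%:R.
Proof.
rewrite (bigD1 q) //= eqxx big1 ?addr0 // => p /negPf->.
by rewrite mulr0.
Qed.

(* Contracting the first three legs with [x] and with vectors orthogonal to
   [x A] and [x B] leaves a rank one matrix on the right, but on the left a
   diagonal matrix which is nonzero at all common nonzero coordinates. *)
Lemma contraction_supports (K : numFieldType) (A B C : 'I_3 -> 'I_3 -> K)
    (X Y Z : 'I_3 -> 'I_3 -> 'I_3 -> K) (x : 'I_3 -> K) :
    (forall p q r s t, A p q * X r s t + B p r * Y q s t + C p s * Z q r t =
       [&& p == t, q == t, r == t & s == t]%:R) ->
    (forall p, x p != 0) ->
  exists i j, [/\ i != j, forall q, (\sum_p x p * A p q != 0) = (q == i)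
                & forall r, (\sum_p x p * B p r != 0) = (r == j)].
Proof.
move=> H x0; set a := fun q => \sum_p x p * A p q.
set b := fun q => \sum_p x p * B p q.
have [y ay yP] := orthogonal_nonzero a; have [z bz zP] := orthogonal_nonzero b.
pose c s := \sum_p x p * C p s.
have H1 q r s t : a q * X r s t + b r * Y q s t + c s * Z q r t =
    x t * [&& q == t, r == t & s == t]%:R.
  rewrite -sum_delta; under eq_bigr do rewrite -H.
  by rewrite /a /b /c !sum_ord3; ring.
have H2 r s t : b r * (\sum_q y q * Y q s t) + c s * (\sum_q y q * Z q r t) =
    x t * (y t * ((r == t) && (s == t))%:R).
  rewrite -sum_delta [RHS]mulr_sumr; under [RHS]eq_bigr do rewrite mulrCA -H1.
  transitivity ((\sum_q a q * y q) * X r s t + b r * (\sum_q y q * Y q s t)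
     + c s * (\sum_q y q * Z q r t)); first by rewrite ay mul0r add0r.
  by rewrite !sum_ord3; ring.
pose w t := \sum_r z r * \sum_q y q * Z q r t.
have H3 s t : c s * w t = x t * (y t * (z t * (s == t)%:R)).
  rewrite -sum_delta ![in RHS]mulr_sumr.
  under [RHS]eq_bigr => r _ do rewrite [y t * _]mulrCA [x t * _]mulrCA -H2.
  transitivity ((\sum_r b r * z r) * (\sum_q y q * Y q s t) + c s * w t).
    by rewrite bz mul0r add0r.
  by rewrite !sum_ord3 /w !sum_ord3; ring.
(* In the rank one matrix [c s * w t], the product of two diagonal entries equals a product of two
   off-diagonal ones, which are 0. *)
have D i j : i != j -> [|| y i == 0, z i == 0, y j == 0 | z j == 0].
  move=> ij; apply/negPn/negP; rewrite !negb_or => /and4P[yi zi yj zj].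
  have : (c i * w i) * (c j * w j) = (c i * w j) * (c j * w i) by ring.
  rewrite !H3 !eqxx (negPf ij) !mulr0 mul0r => /eqP.
  by rewrite !mulf_eq0 oner_eq0 !orbF (negPf (x0 i)) (negPf (x0 j))
             (negPf yi) (negPf yj) (negPf zi) (negPf zj).
have uniq0 (u y' : 'I_3 -> K) : (forall i, y' i = 0 ->
    forall j, (u j != 0) = (j == i)) ->
    forall i j, i != j -> ~~ ((y' i == 0) && (y' j == 0)).
  move=> uP i j; apply: contra => /andP[/eqP/uP ui /eqP/uP uj].
  by rewrite -uj ui.
have yU := uniq0 _ _ yP; have zU := uniq0 _ _ zP.
suff [i [j [ij /eqP/yP yi /eqP/zP zj]]] :
  exists i j, [/\ i != j, y i == 0 & z j == 0] by exists i, j.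
(* Each of [y] and [z] has at most one zero, yet any two coordinates include a zero of [y] or of
   [z]. So both zeros exist, at distinct coordinates. *)
have : [|| (y 0 == 0) && (z 1 == 0), (y 0 == 0) && (z 2%:R == 0),
           (y 1 == 0) && (z 0 == 0), (y 1 == 0) && (z 2%:R == 0),
           (y 2%:R == 0) && (z 0 == 0) | (y 2%:R == 0) && (z 1 == 0)].
  move: (D 0 1 isT) (D 0 2%:R isT) (D 1 2%:R isT).
  move: (yU 0 1 isT) (yU 0 2%:R isT) (yU 1 2%:R isT).
  move: (zU 0 1 isT) (zU 0 2%:R isT) (zU 1 2%:R isT).
  by case: (y 0 == 0); case: (y 1 == 0); case: (y 2%:R == 0);
     case: (z 0 == 0); case: (z 1 == 0); case: (z 2%:R == 0).
case/or4P=> [|||/or3P[]] /andP[yi zj].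
- by exists 0, 1.
- by exists 0, 2%:R.
- by exists 1, 0.
- by exists 1, 2%:R.
- by exists 2%:R, 0.
- by exists 2%:R, 1.
Qed.

Lemma star_pair (K : numFieldType) (A B C : 'I_3 -> 'I_3 -> K)
    (X Y Z : 'I_3 -> 'I_3 -> 'I_3 -> K) :
    (forall p q r s t, A p q * X r s t + B p r * Y q s t + C p s * Z q r t =
       [&& p == t, q == t, r == t & s == t]%:R) ->
  exists m i m' j, [/\ i != j, forall p q, (A p q != 0) = (p == m) && (q == i)
    & forall p q, (B p q != 0) = (p == m') && (q == j)].
Proof.
move=> H.
have [m [i Ai]] : exists m i, forall p q, (A p q != 0) = (p == m) && (q == i).
  apply: single_entry => x /(contraction_supports H)[i [_ [_ xA _]]].
  by exists i.
have [m' [j Bj]] : exists m i, forall p q, (B p q != 0) = (p == m) && (q == i).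
  apply: single_entry => x /(contraction_supports H)[_ [j [_ _ xB]]].
  by exists j.
exists m, i, m', j; split=> //.
have [i' [j' [ij' xA xB]]] := contraction_supports H (fun=> oner_neq0 K).
have sum1 (M : 'I_3 -> 'I_3 -> K) k l : (forall p q, (M p q != 0) =
    (p == k) && (q == l)) -> \sum_p 1 * M p l != 0.
  move=> Mkl; rewrite (bigD1 k) //= big1 ?addr0 ?mul1r ?Mkl ?eqxx //.
  by move=> p /negPf pk; apply/eqP; rewrite mul1r -[_ == 0]negbK Mkl pk.
move: (sum1 A m i Ai) (sum1 B m' j Bj); rewrite xA xB => /eqP-> /eqP->.
exact: ij'.
Qed.

(** Here [p] is the colour at a vertex, [q], [r], [s] are those at three others, and [t] is the
    colour of all the rest. The equation is symmetric in the three matrices, so [star_pair] applies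
    to each pair. Setting all colours to the column of one matrix kills the other two terms, which
    puts its entry on the diagonal. *)
Lemma star_diagonal (K : numFieldType) (A B C : 'I_3 -> 'I_3 -> K)
    (X Y Z : 'I_3 -> 'I_3 -> 'I_3 -> K) :
    (forall p q r s t, A p q * X r s t + B p r * Y q s t + C p s * Z q r t =
       [&& p == t, q == t, r == t & s == t]%:R) ->
  exists i j k, [/\ uniq [:: i; j; k],
    forall p q, (A p q != 0) = (p == i) && (q == i),
    forall p q, (B p q != 0) = (p == j) && (q == j)
  & forall p q, (C p q != 0) = (p == k) && (q == k)].
Proof.
move=> H.
have HAC p q r s t : A p q * X s r t + C p r * Z q s t + B p s * Y q r t =
    [&& p == t, q == t, r == t & s == t]%:R.
  rewrite addrAC H.
  by case: (p == t); case: (q == t); case: (r == t); case: (s == t).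
have HBC p q r s t : B p q * Y s r t + C p r * Z s q t + A p s * X q r t =
    [&& p == t, q == t, r == t & s == t]%:R.
  rewrite addrC addrA H.
  by case: (p == t); case: (q == t); case: (r == t); case: (s == t).
have [m [i [m' [j [ij Ai Bj]]]]] := star_pair H.
have [m1 [i1 [m'' [k [ik Ai1 Ck]]]]] :=
  star_pair (X := fun r s t => X s r t) (Y := Z) HAC.
have [m2 [j2 [m3 [k3 [jk Bj2 Ck3]]]]] :=
  star_pair (X := fun r s t => Y s r t) (Y := fun q s t => Z s q t) HBC.
have e1 : i = i1 by apply/eqP; have := Ai1 m i; rewrite Ai !eqxx => /esym/andP[].
have e2 : j = j2 by apply/eqP; have := Bj2 m' j; rewrite Bj !eqxx => /esym/andP[].
have e3 : k = k3 by apply/eqP; have := Ck3 m'' k; rewrite Ck !eqxx => /esym/andP[].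
subst i1 j2 k3.
have diag (M N P : 'I_3 -> 'I_3 -> K) (X' Y' Z' : K) a a' b b' c c' :
    (forall p q, (M p q != 0) = (p == a) && (q == a')) ->
    (forall p q, (N p q != 0) = (p == b) && (q == b')) ->
    (forall p q, (P p q != 0) = (p == c) && (q == c')) ->
    a' != b' -> a' != c' ->
    M a' a' * X' + N a' a' * Y' + P a' a' * Z' = 1 -> a = a'.
  move=> Ma Nb Pc ab ac sum1; apply/eqP; rewrite eq_sym.
  have -> : (a' == a) = (M a' a' != 0) by rewrite Ma eqxx andbT.
  apply/eqP => M0; move: sum1.
  have -> : N a' a' = 0 by apply/eqP; rewrite -[_ == 0]negbK Nb (negPf ab) andbF.
  have -> : P a' a' = 0 by apply/eqP; rewrite -[_ == 0]negbK Pc (negPf ac) andbF.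
  by rewrite M0 !mul0r !addr0 => /esym/eqP; rewrite oner_eq0.
exists i, j, k; split; first by rewrite /= !inE negb_or ij ik jk.
- have := H i i i i i; rewrite !eqxx.
  move/(diag _ _ _ _ _ _ _ _ _ _ _ _ Ai Bj Ck ij ik) => em.
  by move=> p q; rewrite Ai em.
- have := HBC j j j j j; rewrite !eqxx.
  move/(diag _ _ _ _ _ _ _ _ _ _ _ _ Bj Ck Ai jk); rewrite eq_sym => /(_ ij) em.
  by move=> p q; rewrite Bj em.
- have := H k k k k k; rewrite addrC addrA !eqxx.
  move/(diag _ _ _ _ _ _ _ _ _ _ _ _ Ck Ai Bj); rewrite eq_sym => /(_ ik).
  by rewrite eq_sym => /(_ jk) em p q; rewrite Ck em.
Qed.

(** * Expanding the weight at a vertex *)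

(** Vertices outside [U] must stay uncovered, so deleting vertices changes [U] but never the edge
    type. *)
Definition matching_on (T E : finType) (ends : E -> T * T)
  (c : E -> bool -> nat) (vc : T -> nat) (U : {set T}) (P : {set E}) : bool :=
  [forall e in P, filtered ends c vc e] &&
  [forall x : T, #|[set e in P | incident ends x e]| == (x \in U)].

Definition matching_weight (K : comNzRingType) (T E : finType)
    (ends : E -> T * T)
  (c : E -> bool -> nat) (w : E -> K) (vc : T -> nat) (U : {set T}) : K :=
  \sum_(P : {set E} | matching_on ends c vc U P) \prod_(e in P) w e.

Definition joins (T E : finType) (ends : E -> T * T) (u v : T) (e : E) : bool :=
  (ends e == (u, v)) || (ends e == (v, u)).

(** Parallel edges with the same colours at both ends are merged, whichever way [ends] orients
    them. *)
Definition pair_weight (K : comNzRingType) (T E : finType)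
    (ends : E -> T * T)
  (c : E -> bool -> nat) (w : E -> K) (u v : T) (p q : nat) : K :=
  \sum_(e | (ends e == (u, v)) && (c e false == p) && (c e true == q)
         || (ends e == (v, u)) && (c e false == q) && (c e true == p)) w e.

Lemma perfect_matching_on (T E : finType) (ends : E -> T * T)
    (c : E -> bool -> nat) (vc : T -> nat) (P : {set E}) :
  perfect_matching ends c vc P = matching_on ends c vc setT P.
Proof. by congr (_ && _); apply: eq_forallb => x; rewrite inE. Qed.

Lemma vc_weight_matching (T E : finType) (ends : E -> T * T)
    (c : E -> bool -> nat) (w : E -> Cplx) (vc : T -> nat) :
  vc_weight ends c w vc = matching_weight ends c w vc setT.
Proof. by apply: eq_bigl => P; rewrite perfect_matching_on. Qed.

Lemma matching_on_endpoint (T E : finType) (ends : E -> T * T)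
    (c : E -> bool -> nat) (vc : T -> nat) (U : {set T}) (P : {set E}) x e :
  matching_on ends c vc U P -> e \in P -> incident ends x e -> x \in U.
Proof.
case/andP=> _ /forallP/(_ x)/eqP cardx eP xe; case: (x \in U) cardx => //.
by move/eqP; rewrite cards_eq0 => /eqP/setP/(_ e); rewrite !inE eP xe.
Qed.

Lemma eq_matching_on (T E : finType) (ends : E -> T * T)
    (c : E -> bool -> nat) (vc vc' : T -> nat) (U : {set T}) :
  {in U, vc =1 vc'} -> matching_on ends c vc U =1 matching_on ends c vc' U.
Proof.
suff sub vc1 vc2 : {in U, vc1 =1 vc2} -> forall P,
    matching_on ends c vc1 U P -> matching_on ends c vc2 U P.
  move=> eq_vc P; apply/idP/idP; apply: sub => // x Ux; exact/esym/eq_vc.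
move=> eq_vc P PU; have Pin := matching_on_endpoint PU.
case/andP: PU => /forall_inP Pf Pc; rewrite /matching_on Pc andbT.
apply/forall_inP => e eP; have := Pf e eP; rewrite /filtered !eq_vc //.
  by apply: (Pin _ e) => //; rewrite /incident eqxx orbT.
by apply: (Pin _ e) => //; rewrite /incident eqxx.
Qed.

Lemma eq_matching_weight (K : comNzRingType) (T E : finType)
    (ends : E -> T * T)
    (c : E -> bool -> nat) (w : E -> K) (vc vc' : T -> nat) (U : {set T}) :
  {in U, vc =1 vc'} ->
  matching_weight ends c w vc U = matching_weight ends c w vc' U.
Proof. by move=> eq_vc; apply: eq_bigl; apply: eq_matching_on. Qed.

Lemma matching_weight0 (K : comNzRingType) (T E : finType)
    (ends : E -> T * T)
    (c : E -> bool -> nat) (w : E -> K) (vc : T -> nat) :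
  matching_weight ends c w vc set0 = 1.
Proof.
rewrite /matching_weight (big_pred1 set0) ?big_set0 // => P.
apply/idP/eqP => [PU|->].
  apply/setP => e; rewrite inE; apply/negP => eP.
  have := matching_on_endpoint PU eP (x := (ends e).1).
  by rewrite inE /incident eqxx => /(_ isT).
apply/andP; split; first by apply/forall_inP => e; rewrite inE.
apply/forallP => x; rewrite inE -[false : nat]/0%N cards_eq0.
by apply/eqP/setP => e; rewrite !inE.
Qed.

Lemma matching_on_setU1 (T E : finType) (ends : E -> T * T)
    (c : E -> bool -> nat) (vc : T -> nat) (U : {set T}) (Q : {set E}) e v a :
    v \in U -> a \in U :\ v -> joins ends v a e -> e \notin Q ->
  matching_on ends c vc U (e |: Q) =
    filtered ends c vc e && matching_on ends c vc (U :\ v :\ a) Q.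
Proof.
move=> vU; rewrite !inE => /andP[av aU] vae eQ.
have inc x : incident ends x e = (x == v) || (x == a).
  case/orP: vae => /eqP; rewrite /incident => -> /=; last rewrite orbC.
    by rewrite ![_ == x]eq_sym.
  by rewrite ![_ == x]eq_sym.
rewrite /matching_on andbA; congr (_ && _).
  apply/forall_inP/andP => [H|[fe /forall_inP H] e'].
    split; first by rewrite H ?setU11.
    by apply/forall_inP => e' e'Q; rewrite H ?setU1r.
  by case/setU1P=> [->|/H].
apply: eq_forallb => x; rewrite !inE.
have -> : [set e' in e |: Q | incident ends x e'] =
    if incident ends x e then e |: [set e' in Q | incident ends x e']
    else [set e' in Q | incident ends x e'].
  apply/setP => e'; rewrite (fun_if (fun A : {set E} => e' \in A)) !inE.
  have [->|e'e] := eqVneq e' e; case: (incident ends x e) => //.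
  by rewrite !andbF.
rewrite inc; have [->|xv] := eqVneq x v => /=.
  by rewrite vU andbF cardsU1 inE (negPf eQ) /= add1n eqSS.
have [->|xa] := eqVneq x a => //=.
by rewrite aU cardsU1 inE (negPf eQ) /= add1n eqSS.
Qed.

(** This is the expansion of a hafnian along a row: a matching has exactly one edge at [v], and
    matchings are grouped by its far end. *)
Lemma matching_weight_expand (K : comNzRingType) (T E : finType)
    (ends : E -> T * T)
    (c : E -> bool -> nat) (w : E -> K) (vc : T -> nat) (U : {set T}) v :
    loopless ends -> v \in U ->
  matching_weight ends c w vc U = \sum_(a in U :\ v)
    pair_weight ends c w v a (vc v) (vc a) *
      matching_weight ends c w vc (U :\ v :\ a).
Proof.
move=> nl vU; rewrite /matching_weight.
pose far e := if (ends e).1 == v then (ends e).2 else (ends e).1.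
transitivity (\sum_(P | matching_on ends c vc U P)
    \sum_(e in P | incident ends v e) \prod_(e in P) w e).
  apply: eq_bigr => P /andP[_ /forallP/(_ v)]; rewrite vU => /eqP card1.
  rewrite sumr_const (_ : #|_| = 1%N) ?mulr1n // -[RHS]card1.
  by apply: eq_card => e; rewrite !inE.
have far_joins e a : a != v ->
    incident ends v e && (far e == a) = joins ends v a e.
  move=> av; rewrite /incident /far /joins; case: (ends e) => x y /=.
  rewrite !xpair_eqE; have [->|xv] := eqVneq x v => /=.
    by rewrite [v == a]eq_sym (negPf av) orbF.
  by rewrite andbC.
have far_v e : incident ends v e -> far e != v.
  rewrite /incident /far; have := nl e; case: (ends e) => x y /=.
  by case: (eqVneq x v) => //= ->; rewrite eq_sym.
have far_inc e : incident ends (far e) e.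
  by rewrite /far /incident; case: ifP; rewrite eqxx ?orbT.
transitivity (\sum_(e | incident ends v e && (far e \in U))
    \sum_(P : {set E} | matching_on ends c vc U P && (e \in P))
      \prod_(e' in P) w e').
  rewrite (exchange_big_dep (fun e => incident ends v e && (far e \in U))) /=.
    apply: eq_bigr => e /andP[ve _]; apply: eq_bigl => P.
    by rewrite ve andbT.
  by move=> P e PU /andP[eP ->]; apply: matching_on_endpoint PU eP _.
rewrite (partition_big far [in U :\ v]) /=; last first.
  by move=> e /andP[ve fU]; rewrite !inE far_v.
apply: eq_bigr => a aUv; have [av aU] : a != v /\ a \in U.
  by move: aUv; rewrite !inE => /andP[].
transitivity (\sum_(e | joins ends v a e) \sum_(P : {set E} |
    matching_on ends c vc U P && (e \in P)) \prod_(e' in P) w e').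
  apply: eq_bigl => e; rewrite -far_joins // andbAC.
  by case: eqP => [->|]; rewrite ?aU ?andbT ?andbF.
rewrite /pair_weight mulr_suml.
transitivity (\sum_(e | joins ends v a e && filtered ends c vc e)
    w e * matching_weight ends c w vc (U :\ v :\ a)); last first.
  apply: eq_bigl => e; rewrite /joins /filtered.
  case: (eqVneq (ends e) (v, a)) => [->|_] /=.
    by rewrite xpair_eqE [v == a]eq_sym (negPf av) /= orbF.
  by case: eqP => [->|].
rewrite [RHS]big_mkcondr; apply: eq_bigr => e vae.
case: ifP => [fe|nf].
  rewrite (reindex_onto (fun Q : {set E} => e |: Q) (fun P => P :\ e)).
    cbv beta; rewrite mulr_sumr; apply: eq_big => [Q|Q /andP[_ /eqP QE]].
      (* A set [Q] containing [e] counts on neither side: removing [e] does not give [Q] back, and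
         [e] would cover the deleted vertex [v]. *)
      rewrite setU11 andbT; have [eQ|eQ] := boolP (e \in Q).
        have -> : (e |: Q) :\ e == Q = false.
          by apply/eqP => /setP/(_ e); rewrite !inE eqxx eQ.
        rewrite andbF; apply/esym/negP => QU.
        have inc : incident ends v e.
          by move: vae; rewrite -far_joins // => /andP[].
        by have := matching_on_endpoint QU eQ inc; rewrite !inE eqxx andbF.
      by rewrite setU1K // eqxx andbT (matching_on_setU1 _ _ vU aUv vae eQ) fe.
    rewrite big_setU1 //; apply/negP => eQ; move/setP/(_ e): QE.
    by rewrite !inE eqxx eQ.
  by move=> P /andP[_ eP]; rewrite setD1K.
by apply: big1 => P /andP[/andP[/forall_inP/(_ e) PU _] /PU]; rewrite nf.
Qed.

Lemma pair_weight_sym (K : comNzRingType) (T E : finType)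
    (ends : E -> T * T)
    (c : E -> bool -> nat) (w : E -> K) (u v : T) (p q : nat) :
  pair_weight ends c w u v p q = pair_weight ends c w v u q p.
Proof. by apply: eq_bigl => e; rewrite orbC. Qed.

Lemma pair_weight_nonadjacent (K : comNzRingType) (T E : finType)
    (ends : E -> T * T)
    (c : E -> bool -> nat) (w : E -> K) (g : rel T) (u v : T) (p q : nat) :
  has_skeleton ends g -> ~~ g u v -> pair_weight ends c w u v p q = 0.
Proof.
move=> sk /negP nuv; apply: big1 => e H; case: nuv; apply/sk; exists e.
by case/orP: H => /andP[/andP[/eqP-> _] _]; [left|right].
Qed.

(** In the expansion at [v] only the far end [f (s v) v] contributes, so the weight is a product of
    nonzero pair weights. The induction runs over sets stable under this pairing. *)
Lemma selection_weight_neq0 (K : idomainType) (T E : finType)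
    (ends : E -> T * T)
    (c : E -> bool -> nat) (w : E -> K) (I : eqType) (col : I -> nat)
    (f : I -> T -> T) (s : T -> I) :
    loopless ends ->
    (forall v a p q, (pair_weight ends c w v a (col p) (col q) != 0) =
       (p == q) && (a == f p v)) ->
    (forall p, involutive (f p)) -> (forall p v, f p v != v) ->
    (forall v, s (f (s v) v) = s v) ->
  matching_weight ends c w (col \o s) setT != 0.
Proof.
move=> nl Wf fK fN sf.
have : forall v, v \in setT -> f (s v) v \in setT by move=> v; rewrite !inE.
move: setT => U; have [n] := ubnP #|U|; elim: n U => // n IHn U ltU Uf.
have [->|[v vU]] := set_0Vmem U; first by rewrite matching_weight0 oner_neq0.
have fvU : f (s v) v \in U :\ v by rewrite !inE fN Uf.
rewrite (matching_weight_expand _ _ _ nl vU) (bigD1 (f (s v) v)) //=.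
rewrite big1 ?addr0 => [|a /andP[_ /negPf ne]]; last first.
  apply/eqP; rewrite mulf_eq0; apply/orP; left.
  by rewrite -[_ == 0]negbK Wf ne andbF.
rewrite mulf_neq0 ?Wf ?sf ?eqxx //.
apply: IHn.
  move: ltU; rewrite (cardsD1 v U) vU (cardsD1 (f (s v) v) (U :\ v)) fvU; lia.
move=> u; rewrite !inE => /and3P[ufv uv uU]; rewrite Uf // andbT.
apply/andP; split.
  apply: contra uv => /eqP eq_f; have su : s u = s v by rewrite -sf eq_f sf.
  by move: eq_f; rewrite su => /(can_inj (fK _)) ->.
apply: contra ufv => /eqP eq_f.
have su : s u = s v by rewrite -sf eq_f.
by have := fK (s u) u; rewrite eq_f su => ->.
Qed.

(** * Three feasible colours *)

(** The neighbourhood is padded to exactly three vertices; [o] is a further vertex on which the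
    colour of all the rest is visible. *)
Lemma exists_three_neighbours (T : finType) (g : rel T) (v : T) :
    irreflexive g -> (degree g v <= 3)%N -> (4 < #|T|)%N ->
  exists a b d o, [/\ uniq [:: v; a; b; d; o]
                    & forall u, g v u -> u \in [:: a; b; d]].
Proof.
move=> gI deg card_T; set N := [set u | g v u].
have vN : v \notin N by rewrite inE gI.
have sz s : uniq s -> (size s <= 4)%N -> exists o, o \notin (s : seq T).
  move=> s_uniq le_s; apply/existsP; rewrite -negb_forall; apply/negP.
  move=> /forallP sT; have : (#|T| <= size s)%N.
    rewrite cardE; apply: uniq_leq_size (enum_uniq _) _ => u _; exact: sT.
  by rewrite leqNgt (leq_ltn_trans le_s card_T).
have [s [s_uniq sz_s sN vs]] : exists s : seq T,
    [/\ uniq s, size s = 3%N, {subset N <= s} & v \notin s].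
  have : (#|N| <= 3)%N := deg.
  have : exists s : seq T,
    [/\ uniq s, size s = #|N|, {subset N <= s} & v \notin s].
    exists (enum N); rewrite enum_uniq -cardE mem_enum; split=> // u.
    by rewrite mem_enum.
  move: #|N| => n [s sP] le_n; have [k] := ubnP (3 - n)%N.
  elim: k n s sP le_n => // k IHk n s [s_uniq sz_s sN vs] le_n lt_k.
  have [n3|n3] := eqVneq n 3%N; first by exists s; rewrite sz_s.
  have [] := sz (v :: s); rewrite /= ?vs ?sz_s ?ltnS // => o.
  rewrite inE negb_or => /andP[ov os]; apply: (IHk n.+1 (o :: s)); try lia.
  split; rewrite /= ?os ?sz_s //.
    by move=> u /sN us; rewrite inE us orbT.
  by rewrite inE negb_or eq_sym ov.
have [] := sz (v :: s); rewrite /= ?vs ?sz_s // => o os.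
case: s => [|a [|b [|d []]]] // in s_uniq sz_s sN vs os *.
exists a, b, d, o; split; last by move=> u gvu; apply: sN; rewrite inE.
suff : uniq [:: v; a; b; d; o] by [].
by rewrite -(rot_uniq 4) cons_uniq os cons_uniq vs.
Qed.

(** Expanding at [v] the weight of a selection that is constant off [v] and the three padded
    neighbours gives the equation of [star_diagonal]. *)
Lemma vertex_star (K : numFieldType) (T E : finType) (ends : E -> T * T)
    (c : E -> bool -> nat) (w : E -> K) (g : rel T) (col : 'I_3 -> nat) (v : T) :
    loopless ends -> has_skeleton ends g -> irreflexive g ->
    (degree g v <= 3)%N -> (4 < #|T|)%N ->
    (forall s : T -> 'I_3, matching_weight ends c w (col \o s) setT =
       [forall x, forall y, s x == s y]%:R) ->
  exists f : 'I_3 -> T, forall a p q,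
    (pair_weight ends c w v a (col p) (col q) != 0) = (p == q) && (a == f p).
Proof.
move=> nl sk gI deg card_T ghz.
have [a [b [d [o [uniq_s nbr]]]]] := exists_three_neighbours gI deg card_T.
pose W u p q := pair_weight ends c w v u (col p) (col q).
have W0 u p q : u \notin [:: a; b; d] -> W u p q = 0.
  move=> nu; apply: (pair_weight_nonadjacent _ _ _ _ sk).
  by apply: contra nu => /nbr.
pose s p q r t z (u : T) : 'I_3 := if u == v then p else if u == a then q
  else if u == b then r else if u == d then t else z.
pose R u p q r t z :=
  matching_weight ends c w (col \o s p q r t z) (setT :\ v :\ u).
move: uniq_s; rewrite /= !inE !negb_or -!andbA.
case/and4P=> va vb vd /and5P[vo ab ad ao /and4P[bd bo do_ _]].
have sv p q r t z : s p q r t z v = p by rewrite /s eqxx.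
have sa p q r t z : s p q r t z a = q by rewrite /s eqxx eq_sym (negPf va).
have sb p q r t z : s p q r t z b = r.
  by rewrite /s eqxx !(eq_sym b) (negPf vb) (negPf ab).
have sd p q r t z : s p q r t z d = t.
  by rewrite /s eqxx !(eq_sym d) (negPf vd) (negPf ad) (negPf bd).
have so p q r t z : s p q r t z o = z.
  by rewrite /s !(eq_sym o) (negPf vo) (negPf ao) (negPf bo) (negPf do_).
have H p q r t z : W a p q * R a z z r t z + W b p r * R b z q z t z +
    W d p t * R d z q r z z = [&& p == z, q == z, r == z & t == z]%:R.
  (* Constancy can be tested against [o], which has colour [z]. *)
  have -> : [&& p == z, q == z, r == z & t == z] =
      [forall x, forall y, s p q r t z x == s p q r t z y].
    apply/and4P/forallP => [[/eqP-> /eqP-> /eqP-> /eqP->] x|sxy].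
      by apply/forallP => y; rewrite /s !if_same.
    have sxo x := eqP (forallP (sxy x) o).
    move: (sxo v) (sxo a) (sxo b) (sxo d).
    by rewrite so sv sa sb sd => -> -> -> ->.
  rewrite -ghz (matching_weight_expand _ _ _ nl (in_setT v)).
  rewrite (bigD1 a) ?inE 1?eq_sym ?va //= (bigD1 b) /=; last first.
    by rewrite !inE !andbT ![b == _]eq_sym vb ab.
  rewrite (bigD1 d) /=; last first.
    by rewrite !inE !andbT ![d == _]eq_sym vd ad bd.
  rewrite big1 => [|u /andP[/andP[/andP[_ ua] ub] ud]]; last first.
    by rewrite [pair_weight _ _ _ _ _ _ _]W0 ?mul0r // !inE !negb_or ua ub ud.
  (* The remaining weight does not see the colours of the two deleted vertices, so they are reset to
     [z]. *)
  rewrite sv sa sb sd addr0 addrA; congr (_ * _ + _ * _ + _ * _);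
    apply: eq_matching_weight => u; rewrite !inE /s /=;
    by move=> /andP[/negPf-> /andP[/negPf-> _]].
have [i [j [k [ijk Wa Wb Wd]]]] := star_diagonal
  (X := fun r t z => R a z z r t z) (Y := fun q t z => R b z q z t z)
  (Z := fun q r z => R d z q r z z) H.
exists (fun p => if p == i then a else if p == j then b else d) => u p q.
move: ijk; rewrite /= !inE negb_or andbT => /andP[/andP[ij ik] jk].
have p_ijk : p != i -> p != j -> p == k.
  move: ij ik jk; move: i j k p {Wa Wb Wd}.
  do 4!(apply: forall_ord3); by [].
rewrite -/(W u p q).
have [ua|ua] := eqVneq u a.
  rewrite ua Wa; have [->|pi] := eqVneq p i; first by rewrite eqxx andbT eq_sym.
  by rewrite /=; case: (p == j); rewrite ?(negPf ab) ?(negPf ad) andbF.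
have [ub|ub] := eqVneq u b.
  rewrite ub Wb; have [->|pj] := eqVneq p j.
    by rewrite eq_sym [j == i]eq_sym (negPf ij) eqxx andbT.
  rewrite /=; case: (p == i);
  by rewrite ?(eq_sym b a) ?(negPf ab) ?(negPf bd) andbF.
have [ud|ud] := eqVneq u d.
  rewrite ud Wd; have [->|pk] := eqVneq p k.
    by rewrite ![k == _]eq_sym (negPf ik) (negPf jk) eqxx andbT eq_sym.
  apply/esym; have [_|pi] := eqVneq p i.
    by rewrite [d == a]eq_sym (negPf ad) andbF.
  have [_|pj] := eqVneq p j; first by rewrite [d == b]eq_sym (negPf bd) andbF.
  by move: (p_ijk pi pj); rewrite (negPf pk).
rewrite W0 ?inE ?negb_or ?ua ?ub ?ud // eqxx; apply/esym.
by case: ifP => _; [|case: ifP => _];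
   rewrite ?(negPf ua) ?(negPf ub) ?(negPf ud) andbF.
Qed.

Lemma three_colours_card (K : numFieldType) (T E : finType) (ends : E -> T * T)
    (c : E -> bool -> nat) (w : E -> K) (g : rel T) (col : 'I_3 -> nat) :
    loopless ends -> has_skeleton ends g -> irreflexive g ->
    (forall v, degree g v <= 3)%N ->
    (forall s : T -> 'I_3, matching_weight ends c w (col \o s) setT =
       [forall x, forall y, s x == s y]%:R) ->
  (#|T| <= 4)%N.
Proof.
move=> nl sk gI deg ghz; rewrite leqNgt; apply/negP => card_T.
have [F WF] := fin_all_exists (fun v => vertex_star nl sk gI (deg v) card_T ghz).
pose f p v := F v p.
have fP p v : pair_weight ends c w v (f p v) (col p) (col p) != 0.
  by rewrite WF !eqxx.
(* Read from its other end, the same nonzero pair weight makes [v] the partner of [f p v]. *)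
have fK p : involutive (f p).
  by move=> v; have := fP p v; rewrite pair_weight_sym WF eqxx => /eqP.
have fN p v : f p v != v.
  apply/eqP => fv; have := fP p v; rewrite fv.
  rewrite (pair_weight_nonadjacent _ _ _ _ sk) ?gI ?eqxx //.
suff : (#|T| <= 4)%N by rewrite leqNgt card_T.
apply: (@constant_selections_card T _ f (fun b => if b then 0 else 1) 2%:R) => //.
- by case=> [] [].
- by case.
(* The weight is nonzero, whereas every nonconstant selection has weight 0. *)
move=> s sf; have := selection_weight_neq0 nl WF fK fN sf.
rewrite ghz; case: forallP => [sxy _ u v|_]; last by rewrite eqxx.
exact: eqP (forallP (sxy u) v).
Qed.

Local Close Scope ring_scope.

Theorem theorem5 (T : finType) (g : rel T) :
  simple_graph g -> max_degree g = 3 -> (4 < #|T|)%N ->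
  matching_index_le g 2.
Proof.
move=> [gI _] deg card_T E ends c w nl sk ghz ks ks_uniq ks_feas.
rewrite leqNgt; apply/negP => lt_ks.
have deg3 v : degree g v <= 3 by rewrite -deg; exact: leq_bigmax.
(* The default 0 is never reached, since [ks] holds at least three colours. *)
pose col (p : 'I_3) := nth 0 ks p.
have col_ks p : col p \in ks.
  by apply: mem_nth; apply: leq_trans lt_ks.
have col_inj : injective col.
  move=> p q /eqP; rewrite nth_uniq ?(leq_trans _ lt_ks) // => /eqP.
  exact: val_inj.
suff : #|T| <= 4 by rewrite leqNgt card_T.
apply: (three_colours_card (col := col) (w := w) nl sk gI deg3) => s.
rewrite -vc_weight_matching; have [mono nonmono] := ghz (col \o s).
case: forallP => [sxy|nsxy]; last first.
  apply: nonmono => cs; apply: nsxy => x; apply/forallP => y.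
  by apply/eqP/col_inj/cs.
have sE x y : s x = s y by apply/eqP; exact: (forallP (sxy x)) y.
apply: mono => [x y|]; first by rewrite /= (sE x y).
have [v _] : exists v : T, v \in T by apply/card_gt0P; apply: leq_trans card_T.
have [P PM] := ks_feas _ (col_ks (s v)); exists P; move: PM.
rewrite !perfect_matching_on; congr is_true; apply: eq_matching_on => x _.
by rewrite /= (sE x v).
Qed.
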